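(* Let $R$ be a semiprime ring, let $I$ be a nonzero ideal of $R$, and let $d:R\to R$ be a multiplicative semiderivation associated with a nonzero epimorphism $g$ of $R$. If $d$ acts as a homomorphism on $I$, i.e. $d(xy)=d(x)d(y)$ for all $x,y\in I$, then $[x,d(x)]=0$ for all $x\in I$.
   Context: Rings are associative and not assumed unital or commutative; ideals are two-sided. A ring $R$ is semiprime if for $x\in R$, $xRx=0$ implies $x=0$. For $x,y\in R$, $[x,y]=xy-yx$. A mapping $d:R\to R$ (not assumed additive) is a multiplicative semiderivation associated with a function $g:R\to R$ if (i) $d(xy)=d(x)g(y)+xd(y)=d(x)y+g(x)d(y)$ and (ii) $d(g(x))=g(d(x))$ hold for all $x,y\in R$. An epimorphism of $R$ is a surjective ring homomorphism $R\to R$; nonzero means not the zero map. *)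

(* Defs.v *)
From HB Require Import structures.
From mathcomp Require Import all_boot ssralg.

Set Implicit Arguments.
Unset Strict Implicit.
Unset Printing Implicit Defensive.

Import GRing.Theory.
Local Open Scope ring_scope.

(* The ring structures of ssralg all have a multiplicative unit, so associative
   rings without unit are built here from zmodType and semigroupType. *)

HB.mixin Record Zmodule_Semigroup_isRng R
    of GRing.Zmodule R & Semigroup R := {
  rng_mulDl : left_distributive (@monoid.mul R) +%R;
  rng_mulDr : right_distributive (@monoid.mul R) +%R
}.

#[short(type="rngType")]
HB.structure Definition Rng :=
  { R of GRing.Zmodule R & Semigroup R & Zmodule_Semigroup_isRng R }.

Declare Scope rng_scope.
Delimit Scope rng_scope with rng.
Bind Scope rng_scope with Rng.sort.

(* The %rng on operands keeps nested subterms out of ring_scope, which would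
   demand a unital ring. *)
Notation "0" := (@GRing.zero _) : rng_scope.
Notation "x + y" := (GRing.add x%rng y%rng) : rng_scope.
Notation "- x" := (GRing.opp x%rng) : rng_scope.
Notation "x - y" := (GRing.add x%rng (GRing.opp y%rng)) : rng_scope.
Notation "x * y" := (monoid.mul x%rng y%rng) : rng_scope.

Local Close Scope ring_scope.
Local Open Scope rng_scope.

Section RngDefinitions.

Variable R : rngType.
Implicit Types (x y r : R) (I : R -> Prop) (d g : R -> R).

Definition commutator x y : R := x * y - y * x.

Definition semiprime : Prop :=
  forall x, (forall r, x * r * x = 0) -> x = 0.

(* Prop-valued, so that membership in an ideal need not be decidable. *)
Definition two_sided_ideal I : Prop :=
  [/\ I 0,
      forall x y, I x -> I y -> I (x - y),
      forall r x, I x -> I (r * x)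
    & forall r x, I x -> I (x * r)].

Definition nonzero_ideal I : Prop :=
  two_sided_ideal I /\ exists2 x, I x & x <> 0.

Definition rng_homomorphism g : Prop :=
  {morph g : x y / x + y} /\ {morph g : x y / x * y}.

Definition epimorphism g : Prop :=
  rng_homomorphism g /\ forall y, exists x, g x = y.

Definition nonzero_map g : Prop := ~ (forall x, g x = 0).

Definition mult_semiderivation d g : Prop :=
  [/\ forall x y, d (x * y) = d x * g y + x * d y,
      forall x y, d (x * y) = d x * y + g x * d y
    & forall x, d (g x) = g (d x)].

Definition acts_as_homomorphism_on I d : Prop :=
  forall x y, I x -> I y -> d (x * y) = d x * d y.

End RngDefinitions.

Arguments semiprime R : clear implicits.

(* Main.v *)
(* Expanding d((xy)x) = d(x(yx)) with x, y in I gives (d(x) - x) I d(x) = 0.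
   Hence c = [x, d(x)], which lies in I, satisfies c I d(x) = 0, so c I c = 0,
   and semiprimeness forces c = 0. *)
Require Import Defs.
From mathcomp Require Import all_boot ssralg.
Import GRing.Theory.
Local Open Scope rng_scope.

(** Comparing two expansions of [d] on a triple product shows that [d x] and [x] agree as left
    factors of [y * d z] for [x], [y] in [I]. Hence [c = [x, d x]] kills [I * d x] from the left, so
    [c I c = 0], and semiprimeness gives [c = 0]. *)

Section RngArithmetic.

Variable R : rngType.
Implicit Types x y z : R.

Lemma rng_mul0r x : 0 * x = 0.
Proof. by apply: (@addrI _ (0 * x)); rewrite -rng_mulDl !addr0. Qed.

Lemma rng_mulBl x y z : (x - y) * z = x * z - y * z.
Proof. by apply: (@addIr _ (y * z)); rewrite -rng_mulDl !subrK. Qed.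

Lemma rng_mulBr x y z : x * (y - z) = x * y - x * z.
Proof. by apply: (@addIr _ (x * z)); rewrite -rng_mulDr !subrK. Qed.

End RngArithmetic.

(** Semiprimeness is used twice: [(c r c) s (c r c)] has the middle factor [r c s c r], which lies
    in [I]. *)
Lemma semiprime_ideal_square0 {R : rngType} {I : R -> Prop} {c : R} :
  semiprime R -> two_sided_ideal I -> I c ->
  (forall y, I y -> c * y * c = 0) -> c = 0.
Proof.
move=> sR [_ _ Il Ir] Ic cIc; apply: (sR) => r; apply: sR => s.
rewrite -(cIc (r * c * s * c * r)) ?mulgA //; exact/Ir/Il.
Qed.

Lemma mult_semiderivation_hom_ideal {R : rngType} {I : R -> Prop} {d g : R -> R}
    {x y z : R} :
  two_sided_ideal I -> mult_semiderivation d g ->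
  acts_as_homomorphism_on I d -> I x -> I y -> d x * y * d z = x * y * d z.
Proof.
(* The added term is common to the expansions of [d (x * (y * z))] and [d ((x * y) * z)]. *)
move=> [_ _ _ Ir] [dM _ _] dI Ix Iy; apply: (@addrI _ (d x * d y * g z)).
have <- : d x * d (y * z) = d x * d y * g z + x * y * d z.
  rewrite -(dI x y) // -dM -dI ?mulgA //; exact/Ir.
by rewrite dM rng_mulDr !mulgA.
Qed.

Theorem theorem7 (R : rngType) (I : R -> Prop) (d g : R -> R)
    (R_semiprime : semiprime R)
    (I_nonzero_ideal : nonzero_ideal I)
    (g_epi : epimorphism g)
    (g_nonzero : nonzero_map g)
    (d_semider : mult_semiderivation d g)
    (d_hom_on_I : acts_as_homomorphism_on I d) :
  forall x : R, I x -> commutator x (d x) = 0.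
Proof.
move=> x Ix; have [idI _] := I_nonzero_ideal; have [_ IB Il Ir] := idI.
have dx_x y : I y -> d x * y * d x = x * y * d x.
  exact: mult_semiderivation_hom_ideal idI d_semider d_hom_on_I Ix.
have cId y : I y -> commutator x (d x) * y * d x = 0.
  (* Both terms of the expanded commutator become [d x * d x * y * d x]. *)
  move=> Iy; have xdxy := dx_x (d x * y) (Il _ _ Iy).
  by rewrite !rng_mulBl -(mulgA x) -xdxy -!mulgA (mulgA x) -dx_x // !mulgA subrr.
apply: (semiprime_ideal_square0 R_semiprime idI) => [|y Iy].
  by apply: IB; [exact/Ir | exact/Il].
(* Only the right-hand [c] is expanded; [c * y * d x] and [c * (y * x) * d x] both vanish. *)
rewrite {2}/commutator rng_mulBr !mulgA cId // rng_mul0r subr0.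
rewrite -(mulgA _ y) cId //; exact/Ir.
Qed.
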